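(* Let $(X,d)$ be a complete metric space, let $f:X\longrightarrow\mathbb{R}\cup\{+\infty\}$ be a proper function which is lower semicontinuous on $X$ and bounded from below, let $\underline{\alpha}=\inf_{x\in X}f(x)$, and let $\tau>0$. Then $f$ admits global weak sharp minimizers with modulus $\mathrm{wsha}(f)\ge\tau$ if and only if $$\tau\cdot\sup_{\alpha\in(\underline{\alpha},+\infty)}\mathrm{dist}\left(x,\mathrm{lev}_{\le\alpha}f\right)\le f(x)-\underline{\alpha},\quad\forall x\in X.$$
   Context: Proper means that $f$ is finite at at least one point. For $\alpha\in\mathbb{R}$, $\mathrm{lev}_{\le\alpha}f=\{x\in X: f(x)\le\alpha\}$. For $A\subseteq X$, $\mathrm{dist}(x,A)=\inf_{a\in A}d(x,a)$, with the convention $\mathrm{dist}(x,\varnothing)=+\infty$. $\mathrm{Argmin}(f)=\{x\in X: f(x)\le\underline{\alpha}\}$ is the (possibly empty) set of global minimizers of $f$. The function $f$ is said to have (admit) global weak sharp minimizers if $\mathrm{Argmin}(f)\ne\varnothing$ and there exists $\sigma>0$ such that $\sigma\cdot\mathrm{dist}(x,\mathrm{Argmin}(f))\le f(x)-\underline{\alpha}$ for every $x\in X$. The supremum of all such $\sigma$ is called the modulus of global weak sharpness of $f$ and is denoted by $\mathrm{wsha}(f)$. *)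

(* Defs.v *)
From HB Require Import structures.
From mathcomp Require Import all_boot all_order all_algebra.
From mathcomp Require Import all_classical all_reals all_analysis.

Set Implicit Arguments.
Unset Strict Implicit.
Unset Printing Implicit Defensive.

Import Order.TTheory GRing.Theory Num.Theory.

Local Open Scope classical_set_scope.
Local Open Scope ring_scope.
Local Open Scope ereal_scope.

(* The library's complete spaces carry a base point; as a proper function exists
   only on a nonempty space, this is no restriction here. *)
#[short(type="completeMetricType")]
HB.structure Definition CompleteMetric (R : numDomainType) :=
  { T of Metric R T & Complete T }.

Section WeakSharp.
Context {R : realType} {X : metricType R}.
Implicit Types (f : X -> \bar R) (A : set X).

(* The value is +oo when A is empty, since ereal_inf set0 = +oo. *)
Definition dist (x : X) A : \bar R := ereal_inf [set (mdist x a)%:E | a in A].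

Definition lev f (alpha : R) : set X := [set x | f x <= alpha%:E].

Definition infval f : \bar R := ereal_inf (range f).

Definition Argmin f : set X := [set x | f x <= infval f].

Definition proper_fun f : Prop := exists x, f x \is a fin_num.

Definition bounded_below f : Prop := exists m : R, forall x, m%:E <= f x.

Definition sharpness_constant f (sigma : R) : Prop :=
  (0 < sigma)%R /\ forall x, sigma%:E * dist x (Argmin f) <= f x - infval f.

Definition weak_sharp f : Prop :=
  Argmin f !=set0 /\ exists sigma : R, sharpness_constant f sigma.

(* Extended-real valued: it is +oo when every sigma > 0 is admissible, for
   instance when f is constant. *)
Definition wsha f : \bar R :=
  ereal_sup [set sigma%:E | sigma in sharpness_constant f].

End WeakSharp.

(* Main.v *)
Require Import Defs.
From mathcomp Require Import all_boot all_order all_algebra.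
From mathcomp Require Import all_classical all_reals all_analysis.
From mathcomp Require Import ring lra.

(** Forward direction: the minimizers lie in every sublevel set above the
    infimum m, so the distances to these sublevel sets never exceed the distance
    to the minimizers, while passing to the supremum over the admissible
    constants shows that every real number tau <= wsha f satisfies the
    sharpness inequality itself ([sharp_le_wsha]).

    Backward direction: the hypothesis, read at a point x with f x <= m + d, says
    that every sublevel set of level above m, however close to m, has points at
    distance at most (about) d / tau from x ([lev_ball]). Such steps are chained
    with halving excesses over m; their lengths are then dominated by a
    geometric series, so that the points converge by completeness, and lower
    semicontinuity makes the limit a minimizer ([Argmin_ball_of_small_excess]).
    The total length would exceed d / tau by a constant factor if the excess
    were halved from the start; instead the first step, of length about d / tau,
    lowers the excess below any prescribed threshold, after which the rest of
    the chain is arbitrarily short ([Argmin_ball]). Hence the distance from x to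
    the minimizers is at most d / tau, which is the inequality of weak
    sharpness with constant tau. *)

Set Implicit Arguments.
Unset Strict Implicit.

Import Order.TTheory GRing.Theory Num.Theory.

Local Open Scope classical_set_scope.
Local Open Scope ring_scope.
Local Open Scope ereal_scope.

Section Distance.
Context {R : realType} {X : metricType R}.
Implicit Types (x y : X) (A B : set X).

Lemma dist_ge0 x A : 0 <= dist x A.
Proof.
by apply: le_ereal_inf_tmp => _ [a _ <-]; rewrite lee_fin mdist_ge0.
Qed.

Lemma dist_anti x A B : A `<=` B -> dist x B <= dist x A.
Proof.
move=> AB; apply: le_ereal_inf_tmp => _ [a Aa <-].
by apply: ereal_inf_lbound; exists a => //; exact: AB.
Qed.

Lemma dist_le_ball x y A (r : R) : A y -> ball x r y -> dist x A <= r%:E.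
Proof.
rewrite ballEmdist /= => Ay /ltW xy.
apply: (@le_trans _ _ (mdist x y)%:E); last by rewrite lee_fin.
by apply: ereal_inf_lbound; exists y.
Qed.

Lemma dist_lt_ball x A (r : R) : dist x A < r%:E -> exists2 y, A y & ball x r y.
Proof.
move=> /ereal_inf_lt[_ [y Ay <-]]; rewrite lte_fin => xy.
by exists y => //; rewrite ballEmdist.
Qed.

Lemma dist_fin_num x A : A !=set0 -> dist x A \is a fin_num.
Proof.
move=> [a Aa]; rewrite ge0_fin_numE ?dist_ge0//.
apply: (@le_lt_trans _ _ (mdist x a)%:E); last exact: ltry.
by apply: ereal_inf_lbound; exists a.
Qed.

End Distance.

Lemma infval_fin_num (R : realType) (X : metricType R) (f : X -> \bar R) :
  proper_fun f -> bounded_below f -> infval f \is a fin_num.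
Proof.
move=> [x fx] [c cf]; rewrite fin_numElt; apply/andP; split.
  apply: (@lt_le_trans _ _ c%:E); first exact: ltNyr.
  by apply: le_ereal_inf_tmp => _ [y _ <-].
apply: (@le_lt_trans _ _ (f x)); first by apply: ereal_inf_lbound; exists x.
by move: fx; rewrite fin_numElt => /andP[].
Qed.

Lemma Argmin_sub_lev (R : realType) (X : metricType R) (f : X -> \bar R)
    (alpha : R) :
  infval f < alpha%:E -> Argmin f `<=` lev f alpha.
Proof. by move=> /ltW ma x fx; exact: le_trans ma. Qed.

(** The supremum need not be attained, so [tau] may exceed every admissible
    constant; but [tau - e] lies below one of them for every e > 0, and the
    inequality survives e -> 0 because the distance is finite. *)
Lemma sharp_le_wsha (R : realType) (X : metricType R) (f : X -> \bar R)
    (tau : R) (x : X) :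
  Argmin f !=set0 -> tau%:E <= wsha f ->
  tau%:E * dist x (Argmin f) <= f x - infval f.
Proof.
move=> f0 tw; have Dfin := dist_fin_num x f0; have D0 := dist_ge0 x (Argmin f).
have sharp e : (0 < e)%R -> (tau - e)%:E * dist x (Argmin f) <= f x - infval f.
  move=> e0; have : (tau - e)%:E < wsha f.
    by apply: lt_le_trans tw; rewrite lte_fin; lra.
  move=> /ereal_sup_gt[_ [s [s0 ss] <-]]; rewrite lte_fin => /ltW ts.
  by apply: le_trans (ss x); apply: lee_wpmul2r => //; rewrite lee_fin.
move: Dfin D0 sharp; case: (dist x _) => // r _; rewrite lee_fin => r0 sharp.
apply/lee_subgt0Pr => e e0.
(* r + 1 instead of r, which may be 0 *)
have er0 : (0 < e / (r + 1))%R by apply: divr_gt0 => //; lra.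
apply: le_trans (sharp _ er0); rewrite -!EFinM -EFinB lee_fin mulrBl lerD2l lerN2.
by rewrite mulrAC ler_pdivrMr; nra.
Qed.

(** Steps bounded by the terms of a geometric series of ratio 1/2 stay within
    twice the first bound, and the limit is approached from within that ball;
    the factor 3 leaves room for the passage to the limit in an open ball. *)
Lemma geometric_steps_cvg (R : realType) (X : completeMetricType R)
    (u : nat -> X) (b : R) : (0 < b)%R ->
  (forall n, ball (u n) (b / 2 ^+ n)%R (u n.+1)) ->
  exists2 y, u @ \oo --> y & ball (u 0%N) (3 * b)%R y.
Proof.
move=> b0 step; have pos n : (0 < 2 ^+ n :> R)%R by rewrite exprn_gt0.
have tail k n : ball (u n) (2 * b / 2 ^+ n)%R (u (n + k)%N).
  elim: k n => [|k IH] n.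
    by rewrite addn0; apply: ballxx; rewrite divr_gt0// mulr_gt0.
  have -> : (2 * b / 2 ^+ n = b / 2 ^+ n + 2 * b / 2 ^+ n.+1)%R.
    by rewrite exprS; field; rewrite gt_eqF.
  by apply: ball_triangle (step n) _; rewrite addnS -addSn; exact: IH.
have : cvg (u @ \oo).
  apply/cauchy_cvgP/cauchy_exP => e e0.
  have b2 : (0 < 2 * b)%R by exact: mulr_gt0.
  have [N _ smallN] := near_infty_natSinv_expn_lt (PosNum (divr_gt0 e0 b2)).
  exists (u N), N => // n /= Nn.
  have := tail (n - N)%N N; rewrite subnKC//; apply: le_ball.
  have := smallN N (leqnn N); rewrite /= ltr_pdivlMr ?mulr_gt0// => /ltW.
  by rewrite div1r mulrC.
move=> /cvg_ex[y uy]; exists y => //.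
have [N _ uN] := (cvg_ball uy) _ b0.
have -> : (3 * b = 2 * b + b)%R by ring.
apply: ball_triangle (ball_sym (uN N (leqnn N))).
by have := tail N 0%N; rewrite add0n expr0 divr1.
Qed.

Section SharpLevels.
Context {R : realType} {X : completeMetricType R} {f : X -> \bar R}.
Context {tau m : R}.
Hypothesis tau_gt0 : (0 < tau)%R.
Hypothesis sharp_lev : forall (x : X) (alpha : R), (m < alpha)%R ->
  tau%:E * dist x (lev f alpha) <= f x - m%:E.

(** A bounded distance forces the sublevel set to be nonempty: [alpha] can be
    chosen arbitrarily close to the infimum without affecting [r]. *)
Lemma lev_ball (x : X) (d r alpha : R) :
  f x <= (m + d)%:E -> (d < tau * r)%R -> (m < alpha)%R ->
  exists2 y, f y <= alpha%:E & ball x r y.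
Proof.
move=> fx dr ma; apply: dist_lt_ball.
rewrite -(@lte_pmul2l _ tau%:E) ?lte_fin//.
apply: le_lt_trans (sharp_lev x ma) _.
apply: (@le_lt_trans _ _ d%:E); last by rewrite -EFinM lte_fin.
by rewrite leeBlDr// -EFinD addrC.
Qed.

Lemma Argmin_ball_of_small_excess (x : X) (b : R) :
  lower_semicontinuous f -> (0 < b)%R -> f x <= (m + tau * b / 2)%:E ->
  exists2 y, f y <= m%:E & ball x (3 * b)%R y.
Proof.
move=> f_lsc b0 fx; have pos n : (0 < 2 ^+ n :> R)%R by rewrite exprn_gt0.
have bn0 n : (0 < b / 2 ^+ n)%R by exact: divr_gt0.
(* An excess [tau * r / 2] at a point allows a step of length [r], whatever the
   level to be reached: here r = b / 2 ^+ n. *)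
pose level n : R := (m + tau * (b / 2 ^+ n) / 2)%R.
have level_gt n : (m < level n)%R.
  by rewrite /level ltrDl divr_gt0// mulr_gt0.
(* The implication makes the relation total, as choice requires; [fu] shows that
   its premise holds all along the chain. *)
have /choice[next nextP] (p : nat * X) : exists y,
    f p.2 <= (level p.1)%:E ->
    f y <= (level p.1.+1)%:E /\ ball p.2 (b / 2 ^+ p.1)%R y.
  have [fp|] := pselect (f p.2 <= (level p.1)%:E); last by exists p.2.
  have [|y fy py] := lev_ball fp _ (level_gt p.1.+1) (r := (b / 2 ^+ p.1)%R).
    by have := mulr_gt0 tau_gt0 (bn0 p.1); lra.
  by exists y.
pose u := fix u n := if n is k.+1 then next (k, u k) else x.
have fu n : f (u n) <= (level n)%:E.
  elim: n => [|n IH]; last by case: (nextP (n, u n) IH).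
  by rewrite /level expr0 divr1.
have [y uy xy] : exists2 y, u @ \oo --> y & ball (u 0%N) (3 * b)%R y.
  by apply: geometric_steps_cvg => // n; case: (nextP (n, u n) (fu n)).
exists y => //; apply/lee_addgt0Pr => e e0; rewrite -EFinD leNgt.
apply/negP => /f_lsc[V Vy fV]; have [N1 _ uV] := uy _ Vy.
have tb0 : (0 < tau * b)%R by exact: mulr_gt0.
have [N2 _ smallN] := near_infty_natSinv_expn_lt (PosNum (divr_gt0 e0 tb0)).
have := fV _ (uV _ (leq_maxl N1 N2)); apply/negP; rewrite -leNgt.
apply: le_trans (fu _) _; rewrite lee_fin /level lerD2l.
have := smallN _ (leq_maxr N1 N2); rewrite /= ltr_pdivlMr// div1r.
set q := (_^-1)%R => qe.
have q0 : (0 < q)%R by rewrite invr_gt0.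
nra.
Qed.

(** The two parts of the excess [4 * c] over d / tau: [c] pays for the first
    step, [3 * c] for the chain of halving steps that starts where it ends. *)
Lemma Argmin_ball (x : X) (d c : R) :
  lower_semicontinuous f -> (0 < c)%R -> f x <= (m + d)%:E ->
  exists2 y, f y <= m%:E & ball x (d / tau + 4 * c)%R y.
Proof.
move=> f_lsc c0 fx; have tc0 := mulr_gt0 tau_gt0 c0.
have [||z fz xz] := lev_ball (r := (d / tau + c)%R) (alpha := (m + tau * c / 2)%R) fx.
- by rewrite mulrDr mulrCA divff ?gt_eqF// mulr1 ltrDl.
- by lra.
have [y fy zy] := Argmin_ball_of_small_excess f_lsc c0 fz.
exists y => //; have -> : (d / tau + 4 * c = d / tau + c + 3 * c)%R by ring.
exact: ball_triangle zy.
Qed.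

End SharpLevels.

Theorem theorem2p1 (R : realType) (X : completeMetricType R) (f : X -> \bar R)
    (f_gtNy : forall x : X, f x != -oo)
    (f_proper : proper_fun f)
    (f_lsc : lower_semicontinuous f)
    (f_bnd : bounded_below f)
    (tau : R) (tau_gt0 : (0 < tau)%R) :
  (weak_sharp f /\ tau%:E <= wsha f) <->
  (forall x : X,
     tau%:E * ereal_sup [set dist x (lev f alpha)
                        | alpha in [set alpha : R | infval f < alpha%:E]]
       <= f x - infval f).
Proof.
have [m mE] : exists m : R, infval f = m%:E.
  by exists (fine (infval f)); rewrite fineK// infval_fin_num.
split=> [[[f0 _] tw] x|H].
  apply: le_trans (sharp_le_wsha x f0 tw); apply: lee_wpmul2l.
    by rewrite lee_fin ltW.
  apply: ge_ereal_sup => _ [alpha /Argmin_sub_lev sub <-]; exact: dist_anti.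
have sharp_lev (x : X) (alpha : R) : (m < alpha)%R ->
    tau%:E * dist x (lev f alpha) <= f x - m%:E.
  move=> ma; rewrite -mE; apply: le_trans (H x).
  apply: lee_wpmul2l; first by rewrite lee_fin ltW.
  by apply: ereal_sup_ubound; exists alpha => //=; rewrite mE lte_fin.
have near_Argmin (x : X) (d c : R) : (0 < c)%R -> f x <= (m + d)%:E ->
    exists2 y, Argmin f y & ball x (d / tau + 4 * c)%R y.
  by move=> c0 fx; rewrite /Argmin mE; apply: Argmin_ball.
have sharp : sharpness_constant f tau.
  split=> // x; rewrite mE.
  have [fx|] := boolP (f x \is a fin_num); last first.
    rewrite fin_numE f_gtNy /= negbK => /eqP ->.
    by rewrite addye// leey.
  have fxE : f x = (m + (fine (f x) - m))%:E by rewrite addrC subrK fineK.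
  rewrite {1}fxE -EFinB addrAC subrr add0r -lee_pdivlMl//.
  apply/lee_addgt0Pr => e e0; have c0 : (0 < e / 4)%R by lra.
  have [|y fy xy] := near_Argmin x (fine (f x) - m)%R _ c0; first by rewrite -fxE.
  apply: le_trans (dist_le_ball fy xy) _.
  by rewrite -EFinM -EFinD lee_fin mulrC; lra.
have [x0 fx0] := f_proper.
have [|y0 fy0 _] := near_Argmin x0 (fine (f x0) - m)%R 1%R ltr01.
  by rewrite addrC subrK fineK.
split; first by split; [exists y0 | exists tau].
by apply: ereal_sup_ubound; exists tau.
Qed.
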